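(* Let $f=(f_1,\dots,f_m)$ be real-valued functions of a database with sensitivity $s_f>0$, let $1\le k\le m$ be an integer, and let $\epsilon>0$. If $\lambda \ge 2ks_f/\epsilon$, then the oneshot Laplace mechanism with noise scale $\lambda$, which outputs the set of indices of the $k$ smallest noisy values, is $(\epsilon,0)$-differentially private.
   Context: Databases: two databases $D,D'$ are adjacent if one is obtained from the other by removing or adding a single data item. Sensitivity: for $f=(f_1,\dots,f_m)$, $s_f=\max_{D,D'}\max_{1\le i\le m}|f_i(D)-f_i(D')|$, where the maximum is over all adjacent $D,D'$. Differential privacy: a randomized mechanism $\mathcal{M}$ is $(\epsilon,\delta)$-differentially private if for all adjacent $D,D'$ and every set $S$ of possible outputs, $\mathbb{P}(\mathcal{M}(D)\in S)\le e^{\epsilon}\,\mathbb{P}(\mathcal{M}(D')\in S)+\delta$. Laplace distribution: $\mathrm{Lap}(\lambda)$ has density $\frac{1}{2\lambda}e^{-|z|/\lambda}$ on $\mathbb{R}$. Oneshot Laplace mechanism with noise scale $\lambda>0$: on input $D$, draw $g_1,\dots,g_m$ i.i.d. from $\mathrm{Lap}(\lambda)$, set $y_i=f_i(D)+g_i$ for $1\le i\le m$, sort $y_{i_1}\le y_{i_2}\le\cdots\le y_{i_m}$ (ties occur with probability zero), and return the (unordered) set $\{i_1,\dots,i_k\}$. *)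

(* Defs.v *)
From HB Require Import structures.
From mathcomp Require Import all_boot all_order all_algebra.
From mathcomp Require Import finmap multiset.
From mathcomp Require Import all_classical all_reals all_analysis.

Set Implicit Arguments.
Unset Strict Implicit.
Unset Printing Implicit Defensive.

Import Order.TTheory GRing.Theory Num.Theory.

Local Open Scope classical_set_scope.
Local Open Scope ring_scope.

(* A database is a finite multiset of data items drawn from a universe U. *)
Definition database (U : choiceType) : Type := {mset U}%mset.

Definition adjacent_databases (U : choiceType) (D D' : database U) : Prop :=
  exists x : U, D' = (x +` D)%mset \/ D = (x +` D')%mset.

(* The supremum over pairs of databases is extended-real valued: it is +oo when
   the differences are unbounded, and -oo when there is no adjacent pair
   (U empty), so [sensitivity f = s%:E] with s > 0 excludes both cases. *)
Definition sensitivity (R : realType) (U : choiceType) (m : nat)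
    (f : 'I_m -> database U -> R) : \bar R :=
  ereal_sup [set (\big[Num.max/0]_(i < m) `|f i DD'.1 - f i DD'.2|)%:E
            | DD' in [set DD' : database U * database U |
                       adjacent_databases DD'.1 DD'.2]].

(* M D is the random output on the input D. As the outputs range over a finite
   type, every set of outputs is an event; the first conjunct says that each
   M D is a genuine random element, so that these probabilities make sense. *)
Definition differentially_private (R : realType) (U : choiceType)
    (d : measure_display) (T : measurableType d) (P : probability T R)
    (O : finType) (M : database U -> T -> O) (eps delta : R) : Prop :=
  (forall (D : database U) (S : {set O}), measurable [set w | M D w \in S]) /\
  (forall D D' : database U, adjacent_databases D D' -> forall S : {set O},
     (P [set w | M D w \in S]
        <= (expR eps)%:E * P [set w | M D' w \in S] + delta%:E)%E).

Definition laplace_pdf (R : realType) (lambda z : R) : R :=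
  (2 * lambda)^-1 * expR (- (`|z| / lambda)).

Definition laplace_distributed (R : realType) (lambda : R)
    (d : measure_display) (T : measurableType d) (P : probability T R)
    (X : {RV P >-> R}) : Prop :=
  forall A : set R, measurable A ->
    distribution P X A =
    (\int[lebesgue_measure]_(z in A) (laplace_pdf lambda z)%:E)%E.

Definition mutually_independent (R : realType)
    (d : measure_display) (T : measurableType d) (P : probability T R)
    (I : finType) (X : I -> {RV P >-> R}) : Prop :=
  forall (J : {set I}) (A : I -> set R), (forall i, measurable (A i)) ->
    P [set w | forall i, i \in J -> A i (X i w)] =
    (\prod_(i in J) P (X i @^-1` A i))%E.

(* Ties are broken in favour of the smaller index, [sort] being stable. *)
Definition k_smallest (R : realType) (m k : nat) (y : 'I_m -> R) : {set 'I_m} :=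
  [set i in take k (sort (fun i j => y i <= y j) (enum 'I_m))].

Definition oneshot (R : realType) (U : choiceType) (T : Type) (m k : nat)
    (f : 'I_m -> database U -> R) (g : 'I_m -> T -> R)
    (D : database U) (w : T) : {set 'I_m} :=
  k_smallest k (fun i => f i D + g i w).

(* Main.v *)
Require Import Defs.
From mathcomp Require Import all_boot all_order all_algebra lra.
From mathcomp Require Import all_classical all_reals all_analysis.
From mathcomp Require Import measurable_realfun.

Import Order.TTheory GRing.Theory Num.Theory.

Local Open Scope classical_set_scope.
Local Open Scope ring_scope.

(* Fix a set A of k indices and adjacent databases D, D'. If the noise g makes
   the mechanism output A on D, then lowering g_i by 2s for the i in A makes it
   output A on D': every noisy value moves by at most s, so the values in A drop
   by at least s while the others drop by at most s. Translating one Laplace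
   variable by 2s multiplies probabilities by at most exp(2s/lambda), and only k
   of the independent coordinates are translated, whence the factor
   exp(2ks/lambda) <= exp(eps). Summing over the outputs A gives the result. *)

(** * Selecting the [k] smallest values *)

(* [sort] is stable, so ties are broken by the index. *)
Definition precedes {R : realType} {m : nat} (y : 'I_m -> R) (i j : 'I_m) :=
  (y i < y j) || ((y i == y j) && (i <= j)%N).

(** Since [enum 'I_m] lists the indices increasingly, stability makes the sorted sequence ordered
    lexicographically, by value and then by index. Every entry of its prefix is therefore comparable
    with every entry of its suffix. *)
Lemma k_smallest_precedes {R : realType} {m k : nat} {y : 'I_m -> R} {i j : 'I_m} :
  i \in k_smallest k y -> j \notin k_smallest k y -> precedes y i j.
Proof.
rewrite !inE => iy; set s := sort _ _ in iy *.
have js : j \in take k s ++ drop k s by rewrite cat_take_drop mem_sort mem_enum.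
move=> jNy; rewrite mem_cat (negPf jNy) /= in js.
have le_total : total (fun a b : 'I_m => y a <= y b) by move=> a b; exact: le_total.
have le_trans' : transitive (fun a b : 'I_m => y a <= y b).
  by move=> b a c; exact: le_trans.
have ord_trans : transitive (fun a b : 'I_m => (a <= b)%N).
  by move=> b a c; exact: leq_trans.
have enum_sorted : sorted (fun a b : 'I_m => (a <= b)%N) (enum 'I_m).
  by have := iota_sorted 0 m; rewrite -val_enum_ord sorted_map.
have := sort_stable le_total ord_trans enum_sorted.
(* Passing from neighbours to arbitrary pairs requires transitivity of this lexicographic
   relation. *)
rewrite -/s sorted_pairwise; last first.
  move=> b a c /= /andP[ab ab'] /andP[bc bc'].
  rewrite (le_trans ab bc) /=; apply/implyP => ca.
  rewrite (le_trans bc ca) /= in ab'; rewrite (le_trans ca ab) /= in bc'.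
  exact: leq_trans ab' bc'.
rewrite -(cat_take_drop k s) pairwise_cat => /andP[/allrelP /(_ i j iy js)/= + _].
rewrite /precedes; case: ltgtP => //= _; rewrite ?implybT//.
Qed.

Lemma card_k_smallest {R : realType} {m k : nat} (y : 'I_m -> R) :
  (k <= m)%N -> #|k_smallest k y| = k.
Proof.
move=> km; rewrite cardsE; set s := sort _ _.
have /card_uniqP -> : uniq (take k s) by rewrite take_uniq// sort_uniq enum_uniq.
by rewrite size_takel// size_sort size_enum_ord.
Qed.

Lemma precedes_anti {R : realType} {m : nat} (y : 'I_m -> R) (i j : 'I_m) :
  precedes y i j -> precedes y j i -> i = j.
Proof.
rewrite /precedes; case: ltgtP => //= _ ij ji.
by apply/val_inj/anti_leq; rewrite ij.
Qed.

(** This replaces the sorting algorithm by pairwise comparisons. Two distinct sets of [k] indices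
    each contain an index missing from the other; if both sets satisfied the condition, these two
    indices would precede each other and so coincide. *)
Lemma k_smallestP {R : realType} {m k : nat} (y : 'I_m -> R) (A : {set 'I_m}) :
  (k <= m)%N ->
  k_smallest k y = A <->
  #|A| = k /\ forall i j, i \in A -> j \notin A -> precedes y i j.
Proof.
move=> km; split=> [<-|[cardA Ay]].
  by split=> [|i j]; [exact: card_k_smallest | exact: k_smallest_precedes].
apply/eqP; rewrite eqEcard card_k_smallest// cardA leqnn andbT.
apply/fintype.subsetP => i iy; apply/negPn/negP => iA.
have /fintype.subsetPn[j jA jy] : ~~ (A \subset k_smallest k y).
  apply: contra iA => Asub.
  suff -> : A = k_smallest k y by [].
  by apply/eqP; rewrite eqEcard Asub cardA card_k_smallest// leqnn.
have ij := precedes_anti _ _ _ (k_smallest_precedes iy jy) (Ay _ _ jA iA).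
by rewrite ij jA in iA.
Qed.

(** Each gap [y j - y i] with [i] in [A] and [j] outside can only grow. A strict comparison stays
    strict, and a tie either becomes strict or is still decided by the same indices. *)
Lemma k_smallest_shift {R : realType} {m k : nat} (y y' : 'I_m -> R) (A : {set 'I_m}) :
  (k <= m)%N ->
  (forall i j, i \in A -> j \notin A -> y' i - y i <= y' j - y j) ->
  k_smallest k y = A -> k_smallest k y' = A.
Proof.
move=> km yy' /(k_smallestP _ _ km)[cardA Ay];
apply/k_smallestP => //; split => // i j iA jA.
have := yy' _ _ iA jA; have := Ay _ _ iA jA; rewrite /precedes.
move=> /orP[yij dij|/andP[/eqP yij ->] dij].
  by apply/orP; left; lra.
by rewrite andbT orbC -le_eqVlt; lra.
Qed.

(** * Translating one Laplace variable *)

Lemma measurable_addr {R : realType} (c : R) :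
  measurable_fun setT (fun z : R => z + c).
Proof. by apply: measurable_funD. Qed.

Lemma lebesgue_measure_addr {R : realType} (c : R) (A : set R) : measurable A ->
  pushforward lebesgue_measure (fun z => z + c : measurableTypeR R) A =
  lebesgue_measure A.
Proof.
move=> mA; apply/esym/lebesgue_measure_unique => //=; first exact: measurable_addr.
move=> mc _ [[a b]] _ <-; rewrite /pushforward.
rewrite (_ : _ @^-1` _ = `]a - c, b - c]%classic); last first.
  by apply/seteqP; split => z /=; rewrite !in_itv/= ltrBlDr lerBrDr.
rewrite !lebesgue_measure_itv/= !lte_fin ltrD2r; case: ifP => // _.
by rewrite -!EFinB; congr EFin; lra.
Qed.

Lemma measurable_laplace_pdf {R : realType} (lambda : R) :
  measurable_fun setT (laplace_pdf lambda).
Proof.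
apply: measurable_funM => //; do 2 apply: measurableT_comp => //.
exact: measurable_funM.
Qed.

Lemma laplace_pdf_ge0 {R : realType} (lambda z : R) :
  0 < lambda -> 0 <= laplace_pdf lambda z.
Proof. by move=> l0; rewrite mulr_ge0 ?expR_ge0// invr_ge0 mulr_ge0// ltW. Qed.

(** This is the triangle inequality [|z| <= |z - c| + |c|] inside the exponential. *)
Lemma laplace_pdf_shift {R : realType} (lambda c z : R) : 0 < lambda ->
  laplace_pdf lambda (z - c) <= expR (`|c| / lambda) * laplace_pdf lambda z.
Proof.
move=> l0; rewrite mulrCA -expRD ler_wpM2l//.
  by rewrite invr_ge0 mulr_ge0// ltW.
rewrite ler_expR -mulNr -mulNr -mulrDl ler_pM2r ?invr_gt0//.
by have := ler_normD (z - c) c; rewrite subrK; lra.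
Qed.

(** A change of variables moves the translation from the event to the density, where the pointwise
    bound applies. *)
Lemma laplace_shift {R : realType} {d} {T : measurableType d} {P : probability T R}
    (lambda c : R) (X : {RV P >-> R}) (A : set R) :
  0 < lambda -> laplace_distributed lambda X -> measurable A ->
  (P (X @^-1` [set z | A (z + c)%R]) <=
     (expR (`|c| / lambda))%:E * P (X @^-1` A))%E.
Proof.
move=> l0 lapX mA.
have mc : measurable_fun setT (fun z : measurableTypeR R => z + c : measurableTypeR R).
  exact: measurable_addr.
have mAc : measurable [set z | A (z + c)%R] by rewrite -[X in measurable X]setTI; exact: mc.
(* [lebesgue_measure] lives on [measurableTypeR R], whose canonical measurable
   structure is only convertible to that of [R]. *)
have mA' : measurable (A : set (measurableTypeR R)) := mA.
have mpdf (D : set (measurableTypeR R)) :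
    measurable_fun D (fun z => (laplace_pdf lambda z)%:E).
  by apply/measurable_EFinP; apply: measurable_funS (measurable_laplace_pdf lambda).
have mpdfc (D : set (measurableTypeR R)) :
    measurable_fun D (fun z => (laplace_pdf lambda (z - c)%R)%:E).
  apply/measurable_EFinP; apply: (@measurable_funS _ _ _ _ setT) => //.
  by apply: measurableT_comp (measurable_laplace_pdf lambda) _; exact: measurable_addr.
have -> : P (X @^-1` A) = (\int[lebesgue_measure]_(z in A) (laplace_pdf lambda z)%:E)%E.
  exact: (lapX A mA).
have -> : P (X @^-1` [set z | A (z + c)%R]) =
    (\int[lebesgue_measure]_(z in A) (laplace_pdf lambda (z - c)%R)%:E)%E.
  rewrite [LHS](lapX _ mAc).
  (* By translation invariance, Lebesgue measure is its own pushforward under [z + c], which is the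
     form that the change of variables needs. *)
  transitivity (\int[pushforward lebesgue_measure
      (fun z => (z + c)%R : measurableTypeR R)]_(z in A) (laplace_pdf lambda (z - c)%R)%:E)%E; last first.
    by apply: eq_measure_integral => B mB _; exact: lebesgue_measure_addr.
  have pdfc0 : {in A, forall z, 0 <= (laplace_pdf lambda (z - c)%R)%:E}%E.
    by move=> z _; rewrite lee_fin laplace_pdf_ge0.
  rewrite [RHS](@ge0_integral_pushforward _ _ _ _ R _ mc lebesgue_measure _ _
    mA' (mpdfc A) pdfc0).
  by apply: eq_integral => z _ /=; rewrite addrK.
have pdf0 z : A z -> (0 <= (laplace_pdf lambda z)%:E)%E.
  by move=> _; rewrite lee_fin laplace_pdf_ge0.
rewrite -(ge0_integralZl _ mA' (mpdf A) pdf0) ?lee_fin ?expR_ge0//.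
apply: ge0_le_integral => //.
- by move=> z _; rewrite lee_fin laplace_pdf_ge0.
- exact: (measurable_funeM _ (mpdf A)).
- by move=> z _; rewrite -EFinM lee_fin laplace_pdf_shift.
Qed.

(** * Joint laws on tuples *)

Definition rectangle {R : realType} {m : nat} (A : 'I_m -> set R) : set (m.-tuple R) :=
  [set v | forall i, A i (tnth v i)].

Lemma measurable_rectangle {R : realType} {m : nat} (A : 'I_m -> set R) :
  (forall i, measurable (A i)) -> measurable (rectangle A).
Proof.
move=> mA; rewrite (_ : rectangle A =
    \big[setI/setT]_(i <- index_enum 'I_m) ((@tnth m R)^~ i @^-1` A i)).
  apply: bigsetI_measurable => i _; rewrite -[X in measurable X]setTI.
  exact: measurable_tnth.
rewrite -bigcap_seq; apply/seteqP; split => v vA i; first by move=> _; exact: vA.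
by apply: vA; rewrite /= mem_index_enum.
Qed.

(** Rectangles are stable under intersection and generate the sigma-algebra of tuples; the whole
    space is itself a rectangle, of finite measure. *)
Lemma tuple_measure_unique {R : realType} {m : nat}
    (m1 m2 : {measure set (m.-tuple R) -> \bar R}) :
  (m1 setT < +oo)%E ->
  (forall A : 'I_m -> set R, (forall i, measurable (A i)) ->
     m1 (rectangle A) = m2 (rectangle A)) ->
  forall B, measurable B -> m1 B = m2 B.
Proof.
move=> m1T m12 B mB.
pose G := [set rectangle A | A in [set A : 'I_m -> set R | forall i, measurable (A i)]].
have GT : G setT by exists (fun=> setT) => //; apply/seteqP; split.
apply: (g_sigma_algebra_measure_unique G _ (fun=> setT)) => //.
- by move=> _ [A mA <-]; exact: measurable_rectangle.
- by rewrite bigcup_const.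
- move=> _ _ [A mA <-] [A' mA' <-]; exists (fun i => A i `&` A' i) => [i|].
    exact: measurableI.
  apply/seteqP; split => [v vAA'|v [vA vA'] i]; last by split.
  by split => i; have [] := vAA' i.
- by move=> _ [A mA <-]; exact: m12.
move: mB; apply: smallest_sub; first exact: smallest_sigma_algebra.
move=> C; rewrite -bigcup_seq => -[i _ [D mD <-]]; rewrite setTI.
(* A generator constrains only coordinate [i], so it is a rectangle with full sides elsewhere. *)
apply: sub_sigma_algebra; exists (fun j => if j == i then D else setT).
  by move=> j; case: ifP.
apply/seteqP; split => [v /(_ i)|v vD j]; first by rewrite eqxx.
by case: eqVneq => // ->.
Qed.

Definition joint {R : realType} {T : Type} {m : nat} (X : 'I_m -> T -> R) (w : T) :=
  [tuple X i w | i < m].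

Lemma measurable_joint {R : realType} {d} {T : measurableType d} {m : nat}
    (X : 'I_m -> T -> R) :
  (forall i, measurable_fun setT (X i)) -> measurable_fun setT (joint X).
Proof.
move=> mX; apply/measurable_fun_tnthP => i.
rewrite (_ : _ \o _ = X i)//; apply/funext => w /=; exact: tnth_mktuple.
Qed.

Definition update {R : realType} {m : nat} (i : 'I_m) (zv : R * m.-tuple R) :=
  [tuple if j == i then zv.1 else tnth zv.2 j | j < m].

Lemma measurable_update {R : realType} {m : nat} (i : 'I_m) :
  measurable_fun setT (@update R m i).
Proof.
apply/measurable_fun_tnthP => j; case: (eqVneq j i) => ji.
  rewrite (_ : _ \o _ = fst)//; apply/funext => zv /=.
  by rewrite tnth_mktuple ji eqxx.
rewrite (_ : _ \o _ = (fun v => tnth v j) \o snd).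
  by apply: measurableT_comp => //; exact: measurable_tnth.
by apply/funext => zv /=; rewrite tnth_mktuple (negPf ji).
Qed.

(* By independence, redrawing the coordinate i from its own law leaves the joint
   law unchanged. *)
Lemma prob_joint_update {R : realType} {d} {T : measurableType d} {P : probability T R}
    {m : nat} (X : 'I_m -> {RV P >-> R}) (i : 'I_m) (B : set (m.-tuple R)) :
  mutually_independent X -> measurable B ->
  P (joint (fun i w => X i w) @^-1` B) =
  (\int[P]_w distribution P (X i) [set z | B (update i (z, joint (fun i w => X i w) w))])%E.
Proof.
move=> indX mB; set XX := joint _.
have mXX : measurable_fun setT XX by apply: measurable_joint => j.
pose phi (zw : R * T) := update i (zw.1, XX zw.2).
have mphi : measurable_fun setT phi.
  apply: (measurableT_comp (measurable_update i)).
  apply: measurable_fun_pair => //=; exact: measurableT_comp.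
have mphiB : measurable (phi @^-1` B) by rewrite -[X in measurable X]setTI; exact: mphi.
(* Under [Q] the new value of coordinate [i] is drawn independently of [w]; the goal is that [phi]
   carries [Q] to the joint law. *)
pose Q := (distribution P (X i) \x P)%E.
have rect (A : 'I_m -> set R) : (forall i, measurable (A i)) ->
    pushforward P XX (rectangle A) = pushforward Q phi (rectangle A).
  move=> mA; rewrite /pushforward.
  (* Taking all indices for [J] describes the rectangle event under [XX]. Leaving out [i] describes
     the constraint on [w] under [phi], which discards the old coordinate [i]. *)
  pose W (J : {set 'I_m}) := [set w | forall j, j \in J -> A j (X j w)].
  have mW J : measurable (W J).
    rewrite (_ : W J = \big[setI/setT]_(j <- enum J) (X j @^-1` A j)).
      by apply: bigsetI_measurable => j _; exact: measurable_funPTI.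
    rewrite -bigcap_seq; apply/seteqP; split => w wA j /= jJ; apply: wA.
      by rewrite mem_enum in jJ.
    by rewrite /= mem_enum.
  have -> : XX @^-1` rectangle A = W [set: 'I_m]%SET.
    apply/seteqP; split => w wA j; first by have := wA j; rewrite tnth_mktuple.
    by rewrite tnth_mktuple; apply: wA; rewrite inE.
  have -> : phi @^-1` rectangle A = A i `*` W [set~ i]%SET.
    apply/seteqP; split => [[z w] zwA|[z w] [/= zA wA] j].
      split => [|j] /=; first by have := zwA i; rewrite tnth_mktuple eqxx.
      rewrite !inE => ji; have := zwA j.
      by rewrite tnth_mktuple (negPf ji) tnth_mktuple.
    rewrite tnth_mktuple; case: eqVneq => [->//|ji].
    by rewrite tnth_mktuple; apply: wA; rewrite !inE.
  have PW J : P (W J) = (\prod_(j in J) P (X j @^-1` A j))%E := indX J A mA.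
  rewrite [RHS]product_measure1E// !PW (bigD1 i) ?inE//=; congr (_ * _)%E.
  by rewrite [RHS](PW [set~ i]%SET); apply: eq_bigl => j; rewrite !inE.
have finXX : (pushforward P XX setT < +oo)%E.
  by rewrite /pushforward preimage_setT probability_setT ltry.
rewrite -[LHS]/(pushforward P XX B).
rewrite (tuple_measure_unique (pushforward P XX) (pushforward Q phi) finXX rect B mB)//.
rewrite -[LHS]/(Q (phi @^-1` B)).
(* The two iterated-integral constructions of the product agree; the second integrates over [w]
   last, as the goal requires. *)
rewrite /Q (@product_measure_unique _ _ _ _ _ _ _ (distribution P (X i) \x^ P)%E)//.
  by apply: eq_integral => w _ /=; rewrite ysectionE.
by move=> ? ? ? ?; exact: product_measure2E.
Qed.

(** * Translating several independent coordinates *)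

(** The indices form a sequence so that coordinates can be moved one at a time by induction. Only
    membership counts, so a repeated index is moved once. *)
Definition translate {R : realType} {m : nat} (c : R) (s : seq 'I_m) (v : m.-tuple R) :=
  [tuple if j \in s then tnth v j + c else tnth v j | j < m].

Lemma measurable_translate {R : realType} {m : nat} (c : R) (s : seq 'I_m) :
  measurable_fun setT (translate c s).
Proof.
apply/measurable_fun_tnthP => j; case: (boolP (j \in s)) => js.
  rewrite (_ : _ \o _ = (fun z => z + c) \o (fun v => tnth v j)).
    apply: measurableT_comp; first exact: measurable_addr.
    exact: measurable_tnth.
  by apply/funext => v /=; rewrite tnth_mktuple js.
rewrite (_ : _ \o _ = (fun v => tnth v j)); first exact: measurable_tnth.
by apply/funext => v /=; rewrite tnth_mktuple (negPf js).
Qed.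

Lemma translate_nil {R : realType} {m : nat} (c : R) (v : m.-tuple R) : translate c [::] v = v.
Proof. by apply: eq_from_tnth => j; rewrite tnth_mktuple. Qed.

Lemma translate_cons {R : realType} {m : nat} (c : R) (i : 'I_m) (s : seq 'I_m)
    (v : m.-tuple R) :
  i \notin s -> translate c (i :: s) v = translate c s (translate c [:: i] v).
Proof.
move=> si; apply: eq_from_tnth => j; rewrite !tnth_mktuple !inE.
by case: eqVneq => // ->; rewrite (negPf si).
Qed.

Lemma translate_update {R : realType} {m : nat} (c z : R) (i : 'I_m) (v : m.-tuple R) :
  translate c [:: i] (update i (z, v)) = update i (z + c, v).
Proof.
apply: eq_from_tnth => j; rewrite !tnth_mktuple !inE.
by case: eqVneq.
Qed.

Lemma measurable_preimage_translate {R : realType} {m : nat} (c : R) (s : seq 'I_m)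
    (B : set (m.-tuple R)) :
  measurable B -> measurable (translate c s @^-1` B).
Proof. by move=> mB; rewrite -[X in measurable X]setTI; exact: measurable_translate. Qed.

(** Redrawing coordinate [i] on both sides fixes the others, so the one-variable bound applies for
    each [w] and is then integrated. *)
Lemma shift_coord {R : realType} {d} {T : measurableType d} {P : probability T R}
    {m : nat} (X : 'I_m -> {RV P >-> R}) (C c : R) (i : 'I_m)
    (B : set (m.-tuple R)) :
  mutually_independent X -> 0 <= C ->
  (forall i (A : set R), measurable A ->
    (P (X i @^-1` [set z | A (z + c)%R]) <= C%:E * P (X i @^-1` A))%E) ->
  measurable B ->
  (P (joint (fun i w => X i w) @^-1` (translate c [:: i] @^-1` B)) <=
     C%:E * P (joint (fun i w => X i w) @^-1` B))%E.
Proof.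
move=> indX C_ge0 shiftX mB; set XX := joint _.
have mB' := measurable_preimage_translate c [:: i] _ mB.
have mXX : measurable_fun setT XX by exact: measurable_joint.
have mS (D : set (m.-tuple R)) : measurable D ->
    measurable ((fun zw : R * T => update i (zw.1, XX zw.2)) @^-1` D).
  move=> mD; rewrite -[X in measurable X]setTI.
  suff : measurable_fun setT (fun zw : R * T => update i (zw.1, XX zw.2)) by exact.
  apply: (measurableT_comp (measurable_update i)).
  apply: measurable_fun_pair => //=; exact: measurableT_comp.
have mI (D : set (m.-tuple R)) : measurable D ->
    measurable_fun setT (fun w => distribution P (X i) [set z | D (update i (z, XX w))]).
  move=> mD; have := measurable_fun_ysection (distribution P (X i)) (mS D mD).
  by congr measurable_fun; apply/funext => w /=; rewrite ysectionE.
have mZ w : measurable [set z | B (update i (z, XX w))].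
  by have := measurable_ysection w (mS B mB); rewrite ysectionE.
rewrite (prob_joint_update X i _ indX mB') (prob_joint_update X i _ indX mB).
rewrite -ge0_integralZl//; last exact: mI.
apply: ge0_le_integral => //.
- exact: mI.
- by apply: measurable_funeM; exact: mI.
(* The section of the translated event is the translate by [c] of the section of [B]. *)
- move=> w _; apply: le_trans (shiftX i _ (mZ w)).
  under [X in distribution _ _ X]eq_set do rewrite /preimage/= translate_update.
  exact: lexx.
Qed.

(** Induction on [s], each coordinate costing one factor [C]. The head is moved first, against the
    event already pulled back along the tail. *)
Lemma shift_coords {R : realType} {d} {T : measurableType d} {P : probability T R}
    {m : nat} (X : 'I_m -> {RV P >-> R}) (C c : R) (s : seq 'I_m)
    (B : set (m.-tuple R)) :
  mutually_independent X -> 0 <= C ->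
  (forall i (A : set R), measurable A ->
    (P (X i @^-1` [set z | A (z + c)%R]) <= C%:E * P (X i @^-1` A))%E) ->
  uniq s -> measurable B ->
  (P (joint (fun i w => X i w) @^-1` (translate c s @^-1` B)) <=
     (C ^+ size s)%:E * P (joint (fun i w => X i w) @^-1` B))%E.
Proof.
move=> indX C_ge0 shiftX; set XX := joint _.
elim: s => [_ mB|i s IHs /= /andP[si us] mB].
  by rewrite expr0 mul1e (_ : translate c [::] = id)//; apply/funext/translate_nil.
have := shift_coord X C c i _ indX C_ge0 shiftX
  (measurable_preimage_translate c s _ mB).
have -> : translate c [:: i] @^-1` (translate c s @^-1` B) = translate c (i :: s) @^-1` B.
  by apply/funext => v; rewrite /preimage/= (translate_cons _ _ _ _ si).
move=> /le_trans; apply.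
by rewrite exprS EFinM -muleA lee_wpmul2l// ?lee_fin// IHs.
Qed.

(** * Sensitivity, measurability of outputs and privacy *)

Lemma sensitivity_bound {R : realType} {U : choiceType} {m : nat}
    (f : 'I_m -> database U -> R) (s : R) (D D' : database U) (i : 'I_m) :
  sensitivity f = s%:E -> adjacent_databases D D' -> `|f i D - f i D'| <= s.
Proof.
move=> fs DD'; rewrite -lee_fin -fs.
apply: le_trans (ereal_sup_ubound _); last by exists (D, D').
by rewrite lee_fin; apply: (le_bigmax _ (fun i => `|f i D - f i D'|)).
Qed.

(** By [k_smallestP] the event is empty or a finite intersection of comparisons between two
    coordinates. *)
Lemma measurable_k_smallest {R : realType} {m k : nat} (a : 'I_m -> R) (A : {set 'I_m}) :
  (k <= m)%N ->
  measurable [set v : m.-tuple R | k_smallest k (fun i => a i + tnth v i) = A].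
Proof.
move=> km; have mt (i : 'I_m) : measurable_fun setT (fun v : m.-tuple R => a i + tnth v i).
  by apply: measurable_funD => //; exact: measurable_tnth.
have mprec (i j : 'I_m) :
    measurable [set v : m.-tuple R | precedes (fun i => a i + tnth v i) i j].
  have mlt := measurable_fun_ltr (mt i) (mt j).
  have meq := measurable_fun_eqr (mt i) (mt j).
  have := measurable_or mlt (measurable_and meq (measurable_cst (i <= j)%N)).
  move=> /(_ measurableT [set true]); rewrite setTI; exact.
case: (eqVneq #|A| k) => cA; last first.
  rewrite (_ : [set _ | _] = set0)//; apply/seteqP; split => v //=.
  by move/(k_smallestP _ _ km) => [/eqP]; rewrite (negPf cA).
rewrite (_ : [set _ | _] = \big[setI/setT]_(i <- enum A) \big[setI/setT]_(j <- enum (~: A))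
    [set v : m.-tuple R | precedes (fun i => a i + tnth v i) i j]).
  by apply: bigsetI_measurable => i _; apply: bigsetI_measurable.
rewrite -bigcap_seq; under eq_bigcapr do rewrite -bigcap_seq.
apply/seteqP; split => v /=.
  move/(k_smallestP _ _ km) => [_ Av] i /= + j /=; rewrite !mem_enum !inE; exact: Av.
move=> Av; apply/k_smallestP => //; split => // i j iA jA.
by apply: Av => /=; rewrite mem_enum ?inE.
Qed.

Theorem theorem2p1 (R : realType) (U : choiceType) (m k : nat)
  (f : 'I_m -> database U -> R) (s eps lambda : R)
  (d : measure_display) (T : measurableType d) (P : probability T R)
  (g : 'I_m -> {RV P >-> R})
  (hs : sensitivity f = s%:E) (s_gt0 : 0 < s)
  (k_ge1 : (1 <= k)%N) (k_le_m : (k <= m)%N)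
  (eps_gt0 : 0 < eps)
  (hlambda : 2 * k%:R * s / eps <= lambda)
  (g_laplace : forall i : 'I_m, laplace_distributed lambda (g i))
  (g_indep : mutually_independent g) :
  differentially_private P (oneshot k f (fun i w => g i w)) eps 0.
Proof.
pose out (a : 'I_m -> R) A :=
  [set v : m.-tuple R | k_smallest k (fun i => a i + tnth v i) = A].
have mout a A : measurable (out a A) by exact: measurable_k_smallest.
pose G := joint (fun i w => g i w).
have mG : measurable_fun setT G by exact: measurable_joint.
have mpre B : measurable B -> measurable (G @^-1` B).
  by move=> mB; rewrite -[X in measurable X]setTI; exact: mG.
pose M := oneshot k f (fun i w => g i w).
have ME D A : [set w | M D w = A] = G @^-1` out (f^~ D) A.
  apply/funext => w; rewrite /preimage /out /= /M /oneshot.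
  by congr (k_smallest _ _ = _); apply/funext => i; rewrite tnth_mktuple.
have mM D A : measurable [set w | M D w = A] by rewrite ME; exact: mpre.
have MS D (S : {set {set 'I_m}}) :
    [set w | M D w \in S] = \bigcup_(A in [set` S]) [set w | M D w = A].
  by apply/seteqP; split => w /=; [exists (M D w) | case=> A /= AS ->].
have mMS D (S : {set {set 'I_m}}) : measurable [set w | M D w \in S].
  by rewrite MS; apply: fin_bigcup_measurable.
split=> // D D' DD' S; rewrite adde0.
have PS D0 : P [set w | M D0 w \in S] = (\sum_(A \in [set` S]) P [set w | M D0 w = A])%E.
  rewrite MS measure_fin_bigcup//.
  by apply/trivIsetP => A B _ _ AB; apply/seteqP; split => w //= [-> /eqP]; rewrite (negPf AB).
rewrite -/M !PS ge0_mule_fsumr//.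
apply: lee_fsum => [|A _]; first exact: finite_finset.
(* Positivity of the scale follows from [hlambda], as [k], [s] and [eps] are positive. *)
have lambda_gt0 : 0 < lambda.
  by apply: lt_le_trans hlambda; rewrite !mulr_gt0 ?invr_gt0// ltr0n.
(* An output always has [k] elements, so any other [A] has probability zero. *)
have [cA|cA] := eqVneq #|A| k; last first.
  rewrite (_ : [set w | M D w = A] = set0).
    by rewrite measure0 mule_ge0// lee_fin expR_ge0.
  by apply/seteqP; split => w //= MA; move: cA; rewrite -MA card_k_smallest// eqxx.
pose C := expR (`|- (2 * s)| / lambda).
have sub : [set w | M D w = A] `<=`
    G @^-1` (translate (- (2 * s)) (enum A) @^-1` out (f^~ D') A).
  (* Values in [A] change by at most [s - 2 * s = - s], and the others by at least [- s]. *)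
  rewrite ME => w /=; apply: k_smallest_shift => // i j iA jA.
  rewrite !tnth_mktuple !mem_enum iA (negPf jA).
  have := sensitivity_bound _ _ _ _ i hs DD'; have := sensitivity_bound _ _ _ _ j hs DD'.
  rewrite !ler_norml => /andP[? ?] /andP[? ?]; lra.
have shiftC i (B : set R) (mB : measurable B) :=
  laplace_shift lambda (- (2 * s)) (g i) B lambda_gt0 (g_laplace i) mB.
have := shift_coords g C (- (2 * s)) (enum A) (out (f^~ D') A)
  g_indep (expR_ge0 _) shiftC (enum_uniq _) (mout _ _).
rewrite -/G -ME -cardE cA => shift_le.
apply: le_trans (le_trans _ shift_le) _.
  apply: le_measure => //; rewrite inE; [exact: mM|].
  by apply: mpre; exact: measurable_preimage_translate.
(* The [k] factors [C] multiply to the exponential of [k * (2 * s / lambda)], whose exponent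
   [hlambda] bounds by [eps]. *)
apply: lee_wpmul2r => //; rewrite lee_fin -expRM_natl ler_expR normrN gtr0_norm ?mulr_gt0//.
move: hlambda; rewrite mulrA !ler_pdivrMr//; lra.
Qed.
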